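(* Let $X=\{\lambda_1,\dots,\lambda_N\}$ be a finite set of $N\ge2$ complex numbers. Then the renormalized sum map $s:\mathrm{Lim}^1(X)\to\Gamma_X$ is surjective.
   Context: $\mathrm{Lim}^1(X)$ is the set of all bounded complex sequences $a=(a_n)_{n\ge1}$ with $\sum_{n=1}^\infty d(a_n,X)<\infty$, where $d(z,X)=\min_{\lambda\in X}|z-\lambda|$ (the terms $a_n$ are not required to lie in the convex hull of $X$). $K_X$ is the additive subgroup of $\mathbb{C}$ of all $z=\nu_1\lambda_1+\cdots+\nu_N\lambda_N$ with $\nu_1,\dots,\nu_N\in\mathbb{Z}$ and $\nu_1+\cdots+\nu_N=0$, and $\Gamma_X=\mathbb{C}/K_X$ (quotient of abelian groups). For $a\in\mathrm{Lim}^1(X)$ the renormalized sum $s(a)\in\Gamma_X$ is the coset $\sum_{n=1}^\infty(a_n-x_n)+K_X$, where $x=(x_n)$ is any sequence with $x_n\in X$ for all $n$ and $\sum_n|a_n-x_n|<\infty$; the coset does not depend on the choice of $x$. *)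

(* Defs.v *)
From HB Require Import structures.
From mathcomp Require Import all_boot all_order all_algebra.
From mathcomp Require Import finmap generic_quotient ring_quotient complex.
From mathcomp Require Import all_classical all_reals all_analysis.

Set Implicit Arguments.
Unset Strict Implicit.
Unset Printing Implicit Defensive.

Import Order.TTheory GRing.Theory Num.Theory numFieldNormedType.Exports.
Import ComplexField.Normc.

Local Open Scope classical_set_scope.
Local Open Scope fset_scope.
Local Open Scope ring_scope.
Local Open Scope quotient_scope.

(* The norm topology; [R[i]] itself carries none. *)
HB.instance Definition _ (R : rcfType) := NormedModule.copy R[i] R[i]^o.

Section RenormalizedSum.
Variable R : realType.
Implicit Types (X : {fset R[i]}) (a x : nat -> R[i]).

(* [+oo] only serves as the neutral element of [min]: for nonempty [X] the
   value is a real number.  [normc] is the modulus with values in [R]. *)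
Definition dist (z : R[i]) X : \bar R :=
  (\big[mine/+oo]_(l <- X) (normc (z - l))%:E)%E.

Definition Lim1 X : set (nat -> R[i]) :=
  [set a | bounded_fun a /\ (\sum_(0 <= n <oo) dist (a n) X < +oo)%E].

Definition KX X : {pred R[i]} := fun z =>
  `[< exists2 nu : R[i] -> int,
      \sum_(l <- X) nu l = 0 & z = \sum_(l <- X) l *~ nu l >].

Lemma KX_zmod_closed X : zmod_closed (KX X).
Proof.
split=> [|z w /asboolP[m m0 ->] /asboolP[n n0 ->]]; apply/asboolP.
  by exists (fun=> 0); rewrite big1.
exists (fun l => m l - n l); first by rewrite sumrB m0 n0 subrr.
by rewrite -sumrB; apply: eq_bigr => l _; rewrite mulrzBr.
Qed.
HB.instance Definition _ X :=
  GRing.isZmodClosed.Build R[i] (KX X) (KX_zmod_closed X).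

Definition Gamma X : zmodType := Quotient.quot (KX X).

Definition approximant X a x :=
  (forall n, x n \in X) /\ (\sum_(0 <= n <oo) (normc (a n - x n))%:E < +oo)%E.

Definition renorm_sums X a : set (Gamma X) :=
  [set g | exists x, exists2 z : R[i], approximant X a x &
    series (fun n => a n - x n) @ \oo --> z /\ g = \pi_(Gamma X) z].
Arguments renorm_sums : clear implicits.

(* On [Lim1 X], with [X] nonempty, [renorm_sums X a] is a singleton, by
   [approximant_exists], [approximant_cvg] and [renorm_sumE] below, so the
   default [0] is not used there. *)
Definition renorm_sum X a : Gamma X := xget 0 (renorm_sums X a).

Lemma normc_ge0 (z : R[i]) : 0 <= normc z.
Proof. by case: z => u v /=; exact: sqrtr_ge0. Qed.

Lemma dist_attained X (z : R[i]) : X != fset0 ->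
  exists2 l, l \in X & dist z X = (normc (z - l))%:E.
Proof.
move=> X0.
have H (s : seq R[i]) : s != [::] -> exists2 l, l \in s &
   (\big[mine/+oo]_(l <- s) (normc (z - l))%:E)%E = (normc (z - l))%:E.
  elim: s => // l s IHs _; rewrite big_cons.
  have [->|/IHs[m ms ->]] := eqVneq s [::].
    by rewrite big_nil; exists l; rewrite ?mem_head// minEle leey.
  rewrite minEle; case: ifP => _; first by exists l; rewrite ?mem_head.
  by exists m; rewrite // in_cons ms orbT.
have [|l lX E] := H X; last by exists l.
by rewrite -size_eq0 -[size _]/#|`X| cardfs_eq0.
Qed.

Lemma approximant_exists X a : X != fset0 -> Lim1 X a ->
  exists x, approximant X a x.
Proof.
move=> X0 [_ ha].
have /choice[x hx] : forall n, exists l, l \in X /\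
    dist (a n) X = (normc (a n - l))%:E.
  by move=> n; have [l lX E] := dist_attained (a n) X0; exists l.
exists x; split => [n|]; first by have [] := hx n.
by apply: le_lt_trans ha; apply: lee_nneseries => n _;
  rewrite ?lee_fin ?normc_ge0// (hx n).2.
Qed.

Lemma normed_series_cvg (u v : R^nat) : (forall n, `|u n| <= v n) ->
  (\sum_(0 <= n <oo) (v n)%:E < +oo)%E -> cvgn (series u).
Proof.
move=> uv vfin.
have v0 n : 0 <= v n by apply: le_trans (uv n).
have v0E n : (0 <= (v n)%:E)%E by rewrite lee_fin.
apply: normed_cvg; apply: (@series_le_cvg _ _ v) => //; first by move=> n /=.
apply: nondecreasing_is_cvgn.
  by apply/nondecreasing_seqP => n; rewrite /series/= big_nat_recr//= lerDl.
exists (fine (\sum_(0 <= n <oo) (v n)%:E)%E) => _ [n _ <-].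
rewrite -lee_fin fineK; last by rewrite ge0_fin_numE// nneseries_ge0.
rewrite /series/= -sumEFin; exact: nneseries_lim_ge.
Qed.

Lemma cvg_complex (w : nat -> R[i]) (p q : R) :
  @complex.Re R \o w @ \oo --> p -> @complex.Im R \o w @ \oo --> q -> w @ \oo --> (p +i* q)%C.
Proof.
move=> wp wq; apply/cvgrPdist_lt => e e0.
have [r r0 ->] : exists2 r : R, 0 < r & e = (r%:C)%C.
  by case: e e0 => r s; rewrite ltcE/= => /andP[/eqP-> r0]; exists r.
have r20 : 0 < r / 2 by rewrite divr_gt0.
move/cvgrPdist_lt/(_ _ r20) : wp => wp.
move/cvgrPdist_lt/(_ _ r20) : wq => wq.
near=> n.
have hp : `|p - complex.Re (w n)| < r / 2 by near: n.
have hq : `|q - complex.Im (w n)| < r / 2 by near: n.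
case: (w n) hp hq => c d /= hp hq.
rewrite -[X in `|X|]/((p - c) +i* (q - d))%C normc_def/= ltcR.
have : Num.sqrt ((p - c) ^+ 2 + (q - d) ^+ 2) <= `|p - c| + `|q - d|.
  rewrite -[leRHS]ger0_norm ?addr_ge0// -sqrtr_sqr ler_sqrt ?sqr_ge0//.
  rewrite [leRHS]sqrrD !real_normK ?num_real// lerD2r lerDl mulrn_wge0//.
move/le_lt_trans; apply; rewrite [ltRHS](splitr r); exact: ltrD.
Unshelve. all: by end_near. Qed.

Lemma approximant_cvg X a x : approximant X a x ->
  exists z : R[i], series (fun n => a n - x n) @ \oo --> z.
Proof.
move=> [_ fin]; set c := fun n => a n - x n.
have Rele n : `|complex.Re (c n)| <= normc (c n).
  by case: (c n) => p q /=; rewrite -sqrtr_sqr ler_wsqrtr// lerDl sqr_ge0.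
have Imle n : `|complex.Im (c n)| <= normc (c n).
  by case: (c n) => p q /=; rewrite -sqrtr_sqr ler_wsqrtr// lerDr sqr_ge0.
have /cvg_ex[p hp] := normed_series_cvg Rele fin.
have /cvg_ex[q hq] := normed_series_cvg Imle fin.
exists (p +i* q)%C; apply: cvg_complex.
  rewrite (_ : _ \o _ = series (@complex.Re R \o c))//; apply/funext => n.
  by rewrite /series/=; apply: (big_morph (@complex.Re R)) => // -[? ?] [].
rewrite (_ : _ \o _ = series (@complex.Im R \o c))//; apply/funext => n.
by rewrite /series/=; apply: (big_morph (@complex.Im R)) => // -[? ?] [].
Qed.

Lemma KX_sub X l m : l \in X -> m \in X -> l - m \in KX X.
Proof.
move=> lX mX; apply/asboolP.
have sum1 (V : zmodType) (F : R[i] -> V) k : k \in X ->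
    \sum_(i <- X) F i *~ (i == k) = F k.
  move=> kX; rewrite (big_fsetD1 k)//= eqxx mulr1z big1_seq ?addr0// => i.
  by rewrite !inE/= => /andP[/negbTE -> _]; rewrite mulr0z.
exists (fun i => ((i == l)%:Z - (i == m)%:Z)).
  have S k : k \in X -> \sum_(i <- X) (i == k)%:Z = 1.
    by move=> kX; rewrite -(sum1 int (fun=> 1) k kX); apply: eq_bigr => i _;
      rewrite intz.
  by rewrite sumrB !S// subrr.
under eq_bigr do rewrite mulrzBr.
by rewrite sumrB (sum1 _ id l lX) (sum1 _ id m mX).
Qed.

Lemma eventually_eq X (x y : nat -> R[i]) :
  (forall n, x n \in X) -> (forall n, y n \in X) ->
  (fun n => x n - y n) @ \oo --> (0 : R[i]) ->
  \forall n \near \oo, x n = y n.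
Proof.
move=> xX yX xy0.
pose D : set R[i] := [set d | d \in [fset l - m | l in X, m in X] /\ d != 0].
have finD : finite_set D.
  apply: (@sub_finite_set _ _ [set` [fset l - m | l in X, m in X]]) => //.
  by move=> d [].
have D0 : nbhs (0 : R[i]) (~` D).
  apply: open_nbhs_nbhs; split; last by move=> [_ /eqP].
  apply: closed_openC; apply: (accessible_finite_set_closed.1 _ _ finD).
  exact/hausdorff_accessible/norm_hausdorff.
have : \forall n \near \oo, (~` D) (x n - y n) := xy0 _ D0.
apply: filterS => n nD.
apply/eqP; rewrite -subr_eq0; apply/negPn/negP => xyn; apply: nD.
by split => //; apply/imfset2P; exists (x n); rewrite ?xX//; exists (y n).
Qed.

Lemma series_sub_KX X a x y (z w : R[i]) :
  approximant X a x -> approximant X a y ->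
  series (fun n => a n - x n) @ \oo --> z ->
  series (fun n => a n - y n) @ \oo --> w -> z - w \in KX X.
Proof.
move=> [xX _] [yX _] sz sw.
pose d n := y n - x n.
have sd : series d @ \oo --> z - w.
  rewrite (_ : series d =
    series (fun n => a n - x n) \- series (fun n => a n - y n)).
    exact: (@cvgB _ R[i] _ _ _ _ _ _ _ sz sw).
  apply/funext => n; rewrite /series/= -sumrB; apply: eq_bigr => i _.
  by rewrite /d opprB [RHS]addrC addrA subrK.
have d0 : d @ \oo --> (0 : R[i]).
  by apply: cvg_series_cvg_0; apply/cvg_ex; exists (z - w).
have [N _ hN] := eventually_eq yX xX d0.
suff -> : z - w = series d N by rewrite rpred_sum// => i _; exact: KX_sub.
have sN : series d @ \oo --> series d N.
  apply: cvg_near_cst; exists N => // n /= Nn; apply/eqP.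
  rewrite /series/= (@big_cat_nat _ _ _ N)//= [X in _ + X]big_nat_cond.
  by rewrite [X in _ + X]big1 ?addr0// => i /andP[/andP[Ni _] _];
    rewrite /d hN// subrr.
exact: (cvg_unique (@norm_hausdorff _ R[i]) sd sN).
Qed.

Lemma renorm_sumE X a x (z : R[i]) : approximant X a x ->
  series (fun n => a n - x n) @ \oo --> z ->
  renorm_sum X a = \pi_(Gamma X) z.
Proof.
move=> ax sz; rewrite /renorm_sum; apply: xget_unique.
  by exists x, z.
move=> _ [y [w ay [sw ->]]]; apply/eqP.
by rewrite -Quotient.idealrBE (series_sub_KX ay ax).
Qed.

End RenormalizedSum.

(* Main.v *)
Require Import Defs.
From mathcomp Require Import all_boot all_order all_algebra.
From mathcomp Require Import finmap complex.
From mathcomp Require Import all_classical all_reals all_analysis.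

Local Open Scope classical_set_scope.
Local Open Scope fset_scope.
Local Open Scope ring_scope.

Import Order.TTheory GRing.Theory Num.Theory.
Import ComplexField.Normc.

(** The terms of a sequence in [Lim1 X] may lie anywhere in the plane, so a
    single term already realises any prescribed sum: for [l] in [X] and any
    complex [z], the sequence [l + z, l, l, ...] differs from the constant
    sequence [l] of points of [X] by [z, 0, 0, ...], which is absolutely
    summable with sum [z].  The constant sequence is therefore admissible for
    computing the renormalized sum ([renorm_sumE]), which is the class of [z];
    and every class has such a representative. *)

Lemma dist_le (R : realType) (X : {fset R[i]}) (z l : R[i]) : l \in X ->
  (dist z X <= (normc (z - l))%:E)%E.
Proof. by move=> lX; rewrite /dist; apply: ge_bigmin_seq. Qed.

(** An approximant bounds the distances to [X] termwise, so membership in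
    [Lim1 X] follows without computing any minimum over [X]. *)
Lemma approximant_Lim1 (R : realType) (X : {fset R[i]}) (a x : nat -> R[i]) :
  bounded_fun a -> approximant X a x -> Lim1 X a.
Proof.
move=> ab [xX fin]; split=> //; apply: le_lt_trans fin.
apply: lee_nneseries => n _; last exact: dist_le.
have X0 : X != fset0 by apply/fset0Pn; exists (x n).
by have [l _ ->] := dist_attained (a n) X0; rewrite lee_fin normc_ge0.
Qed.

Lemma sum_nat_head (V : zmodType) (u : nat -> V) n :
  (forall k, u k.+1 = 0) -> (0 < n)%N -> \sum_(0 <= k < n) u k = u 0%N.
Proof.
by case: n => // n u0 _; rewrite big_nat_recl// big1 ?addr0.
Qed.

Theorem mainTheorem4 (R : realType) (X : {fset R[i]}) (hN : (2 <= #|` X|)%N) :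
  set_surj (Lim1 X) [set: Gamma X] (renorm_sum X).
Proof.
have /fset0Pn[l lX] : X != fset0 by rewrite -cardfs_gt0 (ltn_trans _ hN).
move=> g _; pose z : R[i] := repr g.
pose a n : R[i] := if n is 0 then l + z else l.
have aE n : a n - l = if n is 0 then z else 0.
  by case: n => [|n]/=; rewrite ?subrr// addrC addKr.
have fin : approximant X a (fun=> l).
  split=> //; rewrite (_ : limn _ = (normc z)%:E) ?ltry//.
  apply: lim_near_cst => //; exists 1%N => // n /= n1.
  by rewrite sumEFin sum_nat_head ?aE// => k; rewrite aE normc0.
have sz : series (fun n => a n - l) @ \oo --> z.
  apply: cvg_near_cst; exists 1%N => // n /= n1; apply/eqP.
  by rewrite /series/= sum_nat_head ?aE// => k; rewrite aE.
exists a; last by rewrite (renorm_sumE fin sz) reprK.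
apply: approximant_Lim1 fin.
exists (`|l + z| + `|l|); split; first by rewrite realD ?normr_real.
move=> M /ltW hM [|n] _ /=; apply: le_trans hM; first by rewrite lerDl.
by rewrite lerDr.
Qed.
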